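(* Let $n\ge 3$ and $p=(n-2)/(n+1)$. Let $\gamma_d$ with $d>0$ be a $p$-elastic curve with nonconstant curvature in $N^2(\rho)$ defined on its maximal domain. Then the curvature of $\gamma_d$ is a periodic function if and only if $N^2(\rho)=\mathbb{S}^2(\rho)$ (that is, $\rho>0$).
   Context: $N^2(\rho)$ is the $2$-dimensional space form of constant curvature $\rho$: $\mathbb{R}^2$ if $\rho=0$, $\mathbb{S}^2(\rho)$ if $\rho>0$, $\mathbb{H}^2(\rho)$ if $\rho<0$. A $p$-elastic curve is an arc length parametrized curve in $N^2(\rho)$ whose (signed, here positive) curvature $\kappa(s)$ satisfies the Euler-Lagrange equation of $\int_\gamma\kappa^p$, namely $$(p\kappa^{p-1})_{ss}+p\kappa^{p-1}(\kappa^2+\rho)-\kappa^{p+1}=0,$$ regardless of boundary conditions (subscripts $s$ denote derivatives with respect to arc length). If $\kappa$ is nonconstant this equation has the first integral $$\kappa_s^2=\frac{\kappa^2}{p^2(1-p)^2}\left(d\,\kappa^{2(1-p)}-(1-p)^2\kappa^2-\rho\,p^2\right)$$ for a constant of integration $d$; $\gamma_d$ denotes a $p$-elastic curve with nonconstant curvature and with constant of integration $d$. The maximal domain is the maximal interval of the arc length parameter on which the solution is defined. *)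

(* Defs.v *)
From Stdlib Require Import Reals.
From Coquelicot Require Import Coquelicot.
Open Scope R_scope.

Record vec3 : Type := Vec3 { vx : R; vy : R; vz : R }.

Definition vec3_add (u v : vec3) : vec3 :=
  Vec3 (vx u + vx v) (vy u + vy v) (vz u + vz v).

Definition vec3_scale (c : R) (u : vec3) : vec3 :=
  Vec3 (c * vx u) (c * vy u) (c * vz u).

(* N^2(rho) is modelled in R^3, for all rho at once, as the surface
     rho (x^2 + y^2) + z^2 = 1   (the sheet z > 0 when rho <= 0)
   with the metric dx^2 + dy^2 + dz^2 / rho.
   For rho <> 0 the linear change Z = z / sqrt |rho| gives the usual models:
   the sphere x^2 + y^2 + Z^2 = 1 / rho in Euclidean 3-space if rho > 0, and
   the sheet Z > 0 of the hyperboloid x^2 + y^2 - Z^2 = 1 / rho in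
   Minkowski 3-space if rho < 0.
   For rho = 0 it is the Euclidean plane z = 1: tangent vectors have third
   component 0, so the last term of the metric is 0 whatever / 0 is. *)
Definition in_space_form (rho : R) (q : vec3) : Prop :=
  rho * (vx q ^ 2 + vy q ^ 2) + vz q ^ 2 = 1 /\ (rho <= 0 -> 0 < vz q).

Definition metric (rho : R) (u v : vec3) : R :=
  vx u * vx v + vy u * vy v + vz u * vz v / rho.

(* Rotation by +90 degrees in the tangent plane at q: the vector product of q
   and v, with its index raised by the metric.  For rho = 0 it maps
   (v1, v2, 0) to (- v2, v1, 0). *)
Definition rot90 (rho : R) (q v : vec3) : vec3 :=
  Vec3 (vy q * vz v - vz q * vy v)
       (vz q * vx v - vx q * vz v)
       (rho * (vx q * vy v - vy q * vx v)).

Definition velocity (gamma : R -> vec3) (s : R) : vec3 :=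
  Vec3 (Derive (fun t => vx (gamma t)) s)
       (Derive (fun t => vy (gamma t)) s)
       (Derive (fun t => vz (gamma t)) s).

(* Covariant derivative of the velocity of a unit speed curve: the tangential
   part of gamma'' is gamma'' + rho gamma, since differentiating
   <gamma, gamma> = 1 / rho twice yields <gamma'', gamma> = - 1. *)
Definition covariant_acceleration (rho : R) (gamma : R -> vec3) (s : R) : vec3 :=
  vec3_add (velocity (velocity gamma) s) (vec3_scale rho (gamma s)).

Definition signed_curvature (rho : R) (gamma : R -> vec3) (s : R) : R :=
  metric rho (covariant_acceleration rho gamma s)
             (rot90 rho (gamma s) (velocity gamma s)).

Definition in_interval (a b : Rbar) (s : R) : Prop :=
  Rbar_lt a s /\ Rbar_lt s b.

Definition twice_derivable_on (a b : Rbar) (f : R -> R) : Prop :=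
  forall s, in_interval a b s -> ex_derive f s /\ ex_derive (Derive f) s.

Definition arc_length_curve (rho : R) (a b : Rbar) (gamma : R -> vec3) : Prop :=
  twice_derivable_on a b (fun s => vx (gamma s)) /\
  twice_derivable_on a b (fun s => vy (gamma s)) /\
  twice_derivable_on a b (fun s => vz (gamma s)) /\
  (forall s, in_interval a b s ->
     in_space_form rho (gamma s) /\
     metric rho (velocity gamma s) (velocity gamma s) = 1).

(* [Rpower] is the real power x ^ y = exp (y ln x), meaningful for x > 0. *)
Definition euler_lagrange_solution (p rho : R) (a b : Rbar) (kappa : R -> R) : Prop :=
  twice_derivable_on a b kappa /\
  (forall s, in_interval a b s ->
     0 < kappa s /\
     Derive_n (fun t => p * Rpower (kappa t) (p - 1)) 2 s
       + p * Rpower (kappa s) (p - 1) * (kappa s ^ 2 + rho)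
       - Rpower (kappa s) (p + 1) = 0).

Definition p_elastic_curve (p rho : R) (a b : Rbar) (gamma : R -> vec3) : Prop :=
  arc_length_curve rho a b gamma /\
  euler_lagrange_solution p rho a b (signed_curvature rho gamma).

Definition nonconstant_on (a b : Rbar) (f : R -> R) : Prop :=
  exists s t, in_interval a b s /\ in_interval a b t /\ f s <> f t.

Definition constant_of_integration (p rho d : R) (a b : Rbar) (kappa : R -> R) : Prop :=
  forall s, in_interval a b s ->
    Derive kappa s ^ 2 =
      kappa s ^ 2 / (p ^ 2 * (1 - p) ^ 2)
      * (d * Rpower (kappa s) (2 * (1 - p))
         - (1 - p) ^ 2 * kappa s ^ 2 - rho * p ^ 2).

Definition maximal_domain (p rho : R) (a b : Rbar) (kappa : R -> R) : Prop :=
  forall (a' b' : Rbar) (kappa' : R -> R),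
    euler_lagrange_solution p rho a' b' kappa' ->
    (forall s, in_interval a b s -> in_interval a' b' s /\ kappa' s = kappa s) ->
    forall s, in_interval a' b' s -> in_interval a b s.

(* The domain itself has to be invariant under the period, so a function on
   an interval other than the whole line is never periodic. *)
Definition periodic_on (a b : Rbar) (f : R -> R) : Prop :=
  exists T, 0 < T /\
    (forall s, in_interval a b s <-> in_interval a b (s + T)) /\
    (forall s, in_interval a b s -> f (s + T) = f s).

(* Main.v *)
Require Import Defs.
From Stdlib Require Import Reals Lra ClassicalEpsilon.
From Coquelicot Require Import Coquelicot.
Open Scope R_scope.

(** Put [u = kappa ^ (p - 1)].  The Euler-Lagrange equation becomes Newton's
    equation [u'' = F'(u) / 2], and the first integral becomes [u'^2 = F(u)],
    where [F x = d / p^2 - rho x^2 - c x^(-m)] with [c, m > 0].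

    If [rho <= 0] then [u'' > 0], and a strictly convex function cannot take
    the same value at [s], [s + T] and [s + 2 T].

    If [rho > 0] then [F] is strictly concave on [x > 0]; as [u] is not
    constant, [F] is positive somewhere, hence it has two zeros [u1 < u2] and
    [u] stays between them.  Writing [F x = (x - u1) (u2 - x) G x] with
    [G > 0] continuous on [[u1, u2]], the substitution [u = A - B cos theta]
    (midpoint [A], half width [B]) desingularizes the turning points:
    [theta' = sqrt (G (A - B cos theta))] is a flow on the circle with positive
    speed, so it is complete and [u] is periodic.  By uniqueness for Newton's
    equation the given solution is a translate of this one, and by maximality
    its domain is the whole line. *)

Lemma is_derive_MVT (f df : R -> R) (a b : R) :
  a < b -> (forall x, a <= x <= b -> is_derive f x (df x)) ->
  exists c, a < c < b /\ f b - f a = df c * (b - a).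
Proof.
  intros Hab Hd.
  destruct (MVT_cor2 f df a b Hab) as [c [Hc Hin]].
  - intros c Hc. apply is_derive_Reals. now apply Hd.
  - exists c. auto.
Qed.

Lemma is_derive_continuous (f : R -> R) (x l : R) :
  is_derive f x l -> continuous f x.
Proof. intros H. apply (ex_derive_continuous f x). now exists l. Qed.

(** * Strictly concave functions between two zeros *)

(** Strict concavity is expressed by a decreasing derivative, and only for [x > 0], since the
    potential to come has a negative power of [x]. *)
Definition concave_well (F dF : R -> R) (u1 u2 : R) : Prop :=
  0 < u1 < u2 /\ F u1 = 0 /\ F u2 = 0 /\
  (forall x, 0 < x -> is_derive F x (dF x)) /\
  (forall x y, 0 < x < y -> dF y < dF x).

(** Rolle's theorem gives a critical point strictly between the zeros, and [dF] decreases through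
    it. *)
Lemma concave_well_dF (F dF : R -> R) (u1 u2 : R) :
  concave_well F dF u1 u2 -> 0 < dF u1 /\ dF u2 < 0.
Proof.
  intros (Hu & H1 & H2 & HF & Hdec).
  destruct (is_derive_MVT F dF u1 u2) as [c [Hc He]]; try lra.
  - intros x Hx. apply HF. lra.
  - assert (dF c = 0) by nra.
    pose proof (Hdec u1 c). pose proof (Hdec c u2). lra.
Qed.

(** If [F x <= 0], the mean slope would be nonpositive on [[u1, x]] and nonnegative on [[x, u2]],
    against the decrease of [dF]. *)
Lemma concave_well_pos (F dF : R -> R) (u1 u2 x : R) :
  concave_well F dF u1 u2 -> u1 < x < u2 -> 0 < F x.
Proof.
  intros (Hu & H1 & H2 & HF & Hdec) Hx.
  destruct (is_derive_MVT F dF u1 x) as [c [Hc He]]; try lra.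
  { intros y Hy. apply HF. lra. }
  destruct (is_derive_MVT F dF x u2) as [c' [Hc' He']]; try lra.
  { intros y Hy. apply HF. lra. }
  assert (Hlt : dF c' < dF c) by (apply Hdec; lra).
  destruct (Rlt_le_dec 0 (F x)) as [|Hle]; auto.
  assert (dF c <= 0) by nra.
  assert (0 <= dF c') by nra. lra.
Qed.

(** Left of [u1] the slope exceeds [dF u1 > 0], right of [u2] it is below [dF u2 < 0], so [F] is
    negative there. With [u'^2 = F(u)] this confines [u]. *)
Lemma concave_well_range (F dF : R -> R) (u1 u2 x : R) :
  concave_well F dF u1 u2 -> 0 < x -> 0 <= F x -> u1 <= x <= u2.
Proof.
  intros W Hx HFx. destruct (concave_well_dF _ _ _ _ W) as [D1 D2].
  destruct W as (Hu & H1 & H2 & HF & Hdec).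
  split.
  - destruct (Rle_lt_dec u1 x) as [|Hlt]; auto.
    destruct (is_derive_MVT F dF x u1) as [c [Hc He]]; try lra.
    { intros y Hy. apply HF. lra. }
    assert (dF u1 < dF c) by (apply Hdec; lra). nra.
  - destruct (Rle_lt_dec x u2) as [|Hlt]; auto.
    destruct (is_derive_MVT F dF u2 x) as [c [Hc He]]; try lra.
    { intros y Hy. apply HF. lra. }
    assert (dF c < dF u2) by (apply Hdec; lra). nra.
Qed.

(** * Difference quotients and the cofactor of the two zeros *)

(** The value [l] fills the hole at [x0]; taking for [l] the derivative of [f] at [x0] makes the
    quotient continuous there. *)
Definition slope (f : R -> R) (x0 l x : R) : R :=
  if Req_EM_T x x0 then l else (f x - f x0) / (x - x0).

Lemma slope_mult (f : R -> R) (x0 l x : R) :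
  f x - f x0 = slope f x0 l x * (x - x0).
Proof.
  unfold slope. destruct (Req_EM_T x x0) as [->|H]; [ring|field; lra].
Qed.

Lemma slope_is_derive (f : R -> R) (x0 l x d : R) :
  x <> x0 -> is_derive f x d ->
  is_derive (slope f x0 l) x ((d - slope f x0 l x) / (x - x0)).
Proof.
  intros Hx Hf.
  apply is_derive_ext_loc with (fun y => (f y - f x0) / (y - x0)).
  - assert (Hpos : 0 < Rabs (x - x0)) by (apply Rabs_pos_lt; lra).
    exists (mkposreal _ Hpos). intros y Hy. unfold slope.
    destruct (Req_EM_T y x0) as [->|]; auto.
    unfold ball in Hy; simpl in Hy; unfold AbsRing_ball, abs, minus, plus, opp in Hy;
      simpl in Hy.
    replace (x0 + - x) with (- (x - x0)) in Hy by ring. rewrite Rabs_Ropp in Hy. lra.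
  - unfold slope. destruct (Req_EM_T x x0); [lra|].
    auto_derive.
    + split; [now exists d|]. split; [lra|auto].
    + change (Derive (fun y => f y) x) with (Derive f x).
      rewrite (is_derive_unique f x d Hf). field. lra.
Qed.

Lemma slope_continuous (f : R -> R) (x0 l : R) :
  is_derive f x0 l -> continuous (slope f x0 l) x0.
Proof.
  intros Hf. apply is_derive_Reals in Hf.
  apply continuity_pt_filterlim. intros eps He.
  destruct (Hf eps He) as [del Hdel].
  exists del. split; [apply cond_pos|].
  intros x [[_ Hne] Hx]. simpl in *. unfold Rdist in *.
  unfold slope. destruct (Req_EM_T x x0); [lra|].
  destruct (Req_EM_T x0 x0); [|lra].
  specialize (Hdel (x - x0)). replace (x0 + (x - x0)) with x in Hdel by ring.
  apply Hdel; auto; lra.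
Qed.

(* The cofactor [G] of [(x - u1) (u2 - x)] in [F].  Written as an iterated
   difference quotient, it is continuous at the end points without any
   regularity of [F] beyond differentiability. *)
Definition well_quotient (F dF : R -> R) (u1 u2 x : R) : R :=
  - slope (slope F u1 (dF u1)) u2 (dF u2 / (u2 - u1)) x.

Lemma well_quotient_factor (F dF : R -> R) (u1 u2 x : R) :
  concave_well F dF u1 u2 ->
  F x = (x - u1) * (u2 - x) * well_quotient F dF u1 u2 x.
Proof.
  intros (Hu & H1 & H2 & HF & Hdec). unfold well_quotient.
  pose proof (slope_mult F u1 (dF u1) x).
  pose proof (slope_mult (slope F u1 (dF u1)) u2 (dF u2 / (u2 - u1)) x).
  assert (slope F u1 (dF u1) u2 = 0).
  { unfold slope. destruct (Req_EM_T u2 u1); [lra|]. rewrite H1, H2. field. lra. }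
  replace (F x) with (slope F u1 (dF u1) x * (x - u1)) by lra.
  replace (slope F u1 (dF u1) x) with
    (slope (slope F u1 (dF u1)) u2 (dF u2 / (u2 - u1)) x * (x - u2)) by lra.
  ring.
Qed.

Lemma well_quotient_left (F dF : R -> R) (u1 u2 : R) :
  concave_well F dF u1 u2 ->
  well_quotient F dF u1 u2 u1 = dF u1 / (u2 - u1).
Proof.
  intros (Hu & H1 & H2 & HF & Hdec). unfold well_quotient, slope.
  destruct (Req_EM_T u1 u2); [lra|]. destruct (Req_EM_T u1 u1); [|lra].
  destruct (Req_EM_T u2 u1); [lra|]. rewrite H1, H2. field. lra.
Qed.

Lemma well_quotient_right (F dF : R -> R) (u1 u2 : R) :
  well_quotient F dF u1 u2 u2 = - (dF u2 / (u2 - u1)).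
Proof.
  unfold well_quotient, slope at 1. destruct (Req_EM_T u2 u2); lra.
Qed.

(** Inside the well, divide [F x > 0] by the positive factors; at the end points the sign comes from
    [dF u1 > 0 > dF u2]. *)
Lemma well_quotient_pos (F dF : R -> R) (u1 u2 x : R) :
  concave_well F dF u1 u2 -> u1 <= x <= u2 -> 0 < well_quotient F dF u1 u2 x.
Proof.
  intros W Hx. destruct (concave_well_dF _ _ _ _ W) as [D1 D2].
  assert (Hu : 0 < u2 - u1) by (destruct W; lra).
  destruct (Req_dec x u1) as [->|N1].
  { rewrite well_quotient_left by auto. now apply Rdiv_lt_0_compat. }
  destruct (Req_dec x u2) as [->|N2].
  { rewrite well_quotient_right. unfold Rdiv.
    pose proof (Rinv_0_lt_compat _ Hu). nra. }
  pose proof (well_quotient_factor F dF u1 u2 x W) as E.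
  pose proof (concave_well_pos F dF u1 u2 x W).
  apply Rmult_lt_reg_l with ((x - u1) * (u2 - x)); [apply Rmult_lt_0_compat; lra|].
  rewrite <- E. lra.
Qed.

Lemma well_quotient_continuous (F dF : R -> R) (u1 u2 x : R) :
  concave_well F dF u1 u2 -> 0 < x -> continuous (well_quotient F dF u1 u2) x.
Proof.
  intros (Hu & H1 & H2 & HF & Hdec) Hx. unfold well_quotient.
  apply (continuous_opp (V := R_NormedModule)).
  assert (Hs : forall y, 0 < y -> y <> u1 ->
     is_derive (slope F u1 (dF u1)) y ((dF y - slope F u1 (dF u1) y) / (y - u1))).
  { intros y Hy Hne. apply slope_is_derive; auto. }
  destruct (Req_dec x u2) as [->|N2].
  { apply slope_continuous.
    (* The first quotient vanishes at [u2], so the value prescribed there is indeed its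
       derivative. *)
    replace (dF u2 / (u2 - u1)) with ((dF u2 - slope F u1 (dF u1) u2) / (u2 - u1)).
    - apply Hs; lra.
    - unfold slope. destruct (Req_EM_T u2 u1); [lra|]. rewrite H1, H2. field. lra. }
  destruct (Req_dec x u1) as [->|N1].
  (* At [u1] the inner quotient is only known to be continuous, but the outer one is an ordinary
     fraction, as [y] stays away from [u2]. *)
  - apply continuous_ext_loc with
      (fun y => (slope F u1 (dF u1) y - slope F u1 (dF u1) u2) * / (y - u2)).
    + assert (Hpos : 0 < u2 - u1) by lra.
      exists (mkposreal _ Hpos). intros y Hy.
      unfold slope at 3. destruct (Req_EM_T y u2) as [->|]; auto.
      unfold ball in Hy; simpl in Hy; unfold AbsRing_ball, abs, minus, plus, opp in Hy;
        simpl in Hy. apply Rabs_def2 in Hy. lra.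
    + apply (continuous_mult (K := R_AbsRing)).
      * apply (continuous_minus (V := R_NormedModule)).
        -- apply slope_continuous, HF. lra.
        -- apply continuous_const.
      * apply is_derive_continuous with (- / (u1 - u2) ^ 2).
        auto_derive; [lra|field; lra].
  - eapply is_derive_continuous. apply slope_is_derive; auto.
Qed.

(** * Flows of positive speed on the circle *)

Lemma primitive_exists (f : R -> R) :
  (forall x, continuous f x) -> exists H, forall x, is_derive H x (f x).
Proof.
  intros Hf. exists (fun x => RInt f 0 x). intros x.
  apply is_derive_RInt with 0; auto.
  exists (mkposreal 1 Rlt_0_1). intros y _.
  apply (RInt_correct f). apply (ex_RInt_continuous (V := R_CompleteNormedModule)). auto.
Qed.

Lemma derive_zero_constant (f : R -> R) (x y : R) :
  (forall z, is_derive f z 0) -> f x = f y.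
Proof.
  intros Hf. destruct (Rtotal_order x y) as [H|[->|H]]; auto.
  - destruct (is_derive_MVT f (fun _ => 0) x y) as [c [_ E]]; auto. lra.
  - destruct (is_derive_MVT f (fun _ => 0) y x) as [c [_ E]]; auto. lra.
Qed.

Lemma slope_bounds_bijective (H dH : R -> R) (m M : R) :
  0 < m -> (forall x, is_derive H x (dH x)) -> (forall x, m <= dH x <= M) ->
  exists th, (forall t, H (th t) = t) /\ (forall x, th (H x) = x).
Proof.
  intros Hm Hd Hb.
  assert (Hinc : forall x y, x < y -> m * (y - x) <= H y - H x).
  { intros x y Hxy. destruct (is_derive_MVT H dH x y) as [c [_ E]]; auto.
    pose proof (Hb c). nra. }
  assert (Hinj : forall x y, H x = H y -> x = y).
  { intros x y E. destruct (Rtotal_order x y) as [L|[|L]]; auto.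
    - pose proof (Hinc _ _ L). nra.
    - pose proof (Hinc _ _ L). nra. }
  assert (Hsurj : forall t, exists x, H x = t).
  { intros t. set (r := (Rabs (t - H 0) + 1) / m).
    assert (Hr : m * r = Rabs (t - H 0) + 1) by (unfold r; field; lra).
    pose proof (Rabs_pos (t - H 0)).
    assert (0 < r) by nra.
    pose proof (Hinc 0 r). pose proof (Hinc (- r) 0).
    pose proof (Rle_abs (t - H 0)). pose proof (Rle_abs (- (t - H 0))).
    rewrite Rabs_Ropp in *.
    destruct (IVT_gen_consistent H (- r) r t) as [z [_ Hz]].
    - intros z. eapply is_derive_continuous, Hd.
    - rewrite Rmin_left, Rmax_right by lra. lra.
    - now exists z. }
  exists (fun t => proj1_sig (constructive_indefinite_description _ (Hsurj t))).
  assert (Hth : forall t, H (proj1_sig (constructive_indefinite_description _ (Hsurj t))) = t).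
  { intros t. now destruct constructive_indefinite_description. }
  split; auto.
Qed.

(* The mean value theorem for [H] reads [th s - th t = g c * (s - t)], which
   gives first continuity of [th] and then its derivative. *)
Lemma inverse_is_derive (H g th : R -> R) (M : R) :
  (forall x, continuous g x) -> (forall x, 0 < g x <= M) ->
  (forall x, is_derive H x (/ g x)) -> (forall t, H (th t) = t) ->
  forall t, is_derive th t (g (th t)).
Proof.
  intros Hc Hb Hd Hth t.
  assert (Hmv : forall s, exists c, th s - th t = g c * (s - t) /\
             Rabs (c - th t) <= Rabs (th s - th t)).
  { intros s. destruct (Rtotal_order (th s) (th t)) as [L|[E|L]].
    - destruct (is_derive_MVT H (fun x => / g x) _ _ L) as [c [Hin E]]; auto.
      exists c. split.
      + rewrite 2!Hth in E. pose proof (Hb c).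
        apply Rmult_eq_reg_l with (/ g c); [|apply Rinv_neq_0_compat; lra].
        transitivity (s - t); [set (k := / g c) in *; nra|field; lra].
      + rewrite 2!Rabs_left by lra. lra.
    - exists (th t). assert (s = t) by now rewrite <- (Hth s), <- (Hth t), E.
      subst. split; [ring|lra].
    - destruct (is_derive_MVT H (fun x => / g x) _ _ L) as [c [Hin E]]; auto.
      exists c. split.
      + rewrite 2!Hth in E. pose proof (Hb c).
        apply Rmult_eq_reg_l with (/ g c); [|apply Rinv_neq_0_compat; lra].
        transitivity (s - t); [set (k := / g c) in *; nra|field; lra].
      + rewrite 2!Rabs_right by lra. lra. }
  apply is_derive_Reals. intros eps He.
  assert (Hcont : continuity_pt g (th t)) by (apply continuity_pt_filterlim, Hc).
  destruct (Hcont eps He) as [al [Hal Hg]].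
  assert (HM : 0 < M) by (pose proof (Hb 0); lra).
  (* As [g <= M], a time step shorter than [al / M] moves [th], and hence the intermediate point
     [c], by less than [al]. *)
  exists (mkposreal _ (Rdiv_lt_0_compat _ _ Hal HM)).
  intros h Hh0 Hh. simpl in Hh.
  destruct (Hmv (t + h)) as [c [E Hcl]].
  replace ((th (t + h) - th t) / h) with (g c) by (rewrite E; field; auto).
  destruct (Req_dec c (th t)) as [->|Hne].
  { rewrite Rminus_diag, Rabs_R0. lra. }
  apply Hg. split; [split; [exact I|auto]|]. simpl. unfold Rdist.
  apply Rle_lt_trans with (1 := Hcl). rewrite E.
  replace (t + h - t) with h by ring. rewrite Rabs_mult.
  pose proof (Hb c). rewrite (Rabs_right (g c)) by lra.
  apply Rle_lt_trans with (M * Rabs h).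
  - apply Rmult_le_compat_r; [apply Rabs_pos|lra].
  - apply Rmult_lt_reg_r with (/ M); [now apply Rinv_0_lt_compat|].
    replace (M * Rabs h * / M) with (Rabs h) by (field; lra). exact Hh.
Qed.

(** Separation of variables: a primitive [H] of [1 / g] is the time as a function of the phase, and
    [th] is its inverse. By periodicity of [g], each turn [P] takes the same time
    [T = H P - H 0]. *)
Lemma periodic_flow (g : R -> R) (m M P : R) :
  0 < m -> 0 < P -> (forall x, continuous g x) -> (forall x, m <= g x <= M) ->
  (forall x, g (x + P) = g x) ->
  exists th T, 0 < T /\ (forall t, is_derive th t (g (th t))) /\
    (forall t, th (t + T) = th t + P) /\ (forall x, exists t, th t = x).
Proof.
  intros Hm HP Hc Hb Hper.
  assert (Hci : forall x, continuous (fun y => / g y) x).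
  { intros x. apply continuous_Rinv_comp; auto. pose proof (Hb x). lra. }
  destruct (primitive_exists _ Hci) as [H HH].
  assert (HM : 0 < M) by (pose proof (Hb 0); lra).
  destruct (slope_bounds_bijective H (fun x => / g x) (/ M) (/ m)) as [th [E1 E2]]; auto.
  { now apply Rinv_0_lt_compat. }
  { intros x. pose proof (Hb x). split; apply Rinv_le_contravar; lra. }
  assert (Hshift : forall x, H (x + P) = H x + (H P - H 0)).
  { intros x.
    assert (E : H (x + P) - H x = H (0 + P) - H 0).
    { apply (derive_zero_constant (fun y => H (y + P) - H y)). intros y.
      auto_derive.
      - split; [exists (/ g (y + P)); auto|]. split; [exists (/ g y); auto|auto].
      - change (Derive (fun x => H x)) with (Derive H).
        rewrite (is_derive_unique H _ _ (HH y)), (is_derive_unique H _ _ (HH (y + P))).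
        rewrite Hper. ring. }
    rewrite Rplus_0_l in E. lra. }
  exists th, (H P - H 0). split; [|split; [|split]].
  - destruct (is_derive_MVT H (fun x => / g x) 0 P) as [c [_ E]]; auto.
    rewrite E. pose proof (Hb c).
    assert (0 < / g c) by (apply Rinv_0_lt_compat; lra). nra.
  - apply (inverse_is_derive H g th M); auto. intros x. pose proof (Hb x). lra.
  - intros t. rewrite <- (E2 (th t + P)). rewrite Hshift, E1. reflexivity.
  - intros x. exists (H x). auto.
Qed.

(** * The periodic solution of Newton's equation in a well *)

(** By continuity [y] keeps its sign near [t], so it equals [sqrt (y^2)] or its opposite there. *)
Lemma is_derive_sqr_inv (y : R -> R) (t z : R) :
  continuous y t -> y t <> 0 -> is_derive (fun s => y s ^ 2) t z ->
  is_derive y t (z / (2 * y t)).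
Proof.
  intros Hc H0 Hz.
  assert (Hsq : is_derive (fun s => sqrt (y s ^ 2)) t (z / (2 * Rabs (y t)))).
  { assert (0 < y t ^ 2) by nra.
    replace (z / (2 * Rabs (y t))) with (z * / (2 * sqrt (y t ^ 2))).
    - apply (is_derive_comp sqrt (fun s => y s ^ 2) t (/ (2 * sqrt (y t ^ 2))) z); auto.
      apply is_derive_Reals, derivable_pt_lim_sqrt; auto.
    - replace (y t ^ 2) with (Rsqr (y t)) by (unfold Rsqr; ring).
      rewrite sqrt_Rsqr_abs. reflexivity. }
  assert (Habs : forall x, sqrt (x ^ 2) = Rabs x).
  { intros x. replace (x ^ 2) with (Rsqr x) by (unfold Rsqr; ring). apply sqrt_Rsqr_abs. }
  destruct (Rdichotomy _ _ H0) as [Hn|Hp].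
  - apply is_derive_ext_loc with (fun s => - sqrt (y s ^ 2)).
    + assert (Hl : locally t (fun s => y s < 0)) by apply (Hc _ (open_lt 0 (y t) Hn)).
      revert Hl. apply filter_imp. intros s Hs.
      rewrite Habs, Rabs_left; lra.
    + replace (z / (2 * y t)) with (- (z / (2 * Rabs (y t)))).
      * apply (is_derive_opp (V := R_NormedModule)). exact Hsq.
      * rewrite Rabs_left by lra. field. lra.
  - apply is_derive_ext_loc with (fun s => sqrt (y s ^ 2)).
    + assert (Hl : locally t (fun s => 0 < y s)) by apply (Hc _ (open_gt 0 (y t) Hp)).
      revert Hl. apply filter_imp. intros s Hs.
      rewrite Habs, Rabs_right; lra.
    + rewrite Rabs_right in Hsq by lra. exact Hsq.
Qed.

(** Because [f t = 0], the difference quotient of the product is that of [f] times [h], so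
    continuity of [h] suffices. *)
Lemma is_derive_mult_zero (f h : R -> R) (t l : R) :
  f t = 0 -> is_derive f t l -> continuous h t ->
  is_derive (fun s => f s * h s) t (l * h t).
Proof.
  intros H0 Hf Hh.
  assert (Hs : continuous (fun s => slope f t l s * h s) t).
  { apply (continuous_mult (K := R_AbsRing)); auto. now apply slope_continuous. }
  apply is_derive_Reals. intros eps He.
  apply continuity_pt_filterlim in Hs.
  destruct (Hs eps He) as [al [Hal Hq]].
  exists (mkposreal _ Hal). intros x Hx0 Hx. simpl in Hx.
  specialize (Hq (t + x)). simpl in Hq. unfold Rdist, slope in Hq.
  destruct (Req_EM_T t t) as [_|]; [|lra].
  destruct (Req_EM_T (t + x) t) as [|_]; [lra|].
  replace (t + x - t) with x in Hq by ring.
  rewrite H0 in Hq |- *.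
  replace ((f (t + x) * h (t + x) - 0 * h t) / x) with ((f (t + x) - 0) / x * h (t + x))
    by (field; auto).
  apply Hq. split; [split; [exact I|lra]|auto].
Qed.

(** The last clause says that the orbit fills the whole energy level; it serves to match the initial
    data of a given solution. *)
Lemma concave_well_periodic_solution (F dF : R -> R) (u1 u2 : R) :
  concave_well F dF u1 u2 ->
  exists (U V : R -> R) (T : R), 0 < T /\
    (forall t, U (t + T) = U t) /\ (forall t, u1 <= U t <= u2) /\
    (forall t, is_derive U t (V t)) /\ (forall t, is_derive V t (dF (U t) / 2)) /\
    (forall x y, u1 <= x <= u2 -> y ^ 2 = F x -> exists t, U t = x /\ V t = y).
Proof.
  intros W. pose proof W as ((Hu1 & Hu2) & HF1 & HF2 & HF & Hdec).
  set (A := (u1 + u2) / 2). set (B := (u2 - u1) / 2).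
  set (X := fun th => A - B * cos th).
  assert (HX : forall th, u1 <= X th <= u2).
  { intros th. unfold X, A, B. pose proof (COS_bound th). nra. }
  assert (HB : 0 < B) by (unfold B; lra).
  set (G := well_quotient F dF u1 u2).
  assert (HGc : forall x, 0 < x -> continuous G x) by now intros; apply well_quotient_continuous.
  assert (HGp : forall x, u1 <= x <= u2 -> 0 < G x).
  { intros; now apply (well_quotient_pos F dF u1 u2). }
  set (g := fun th => sqrt (G (X th))).
  assert (HGcp : forall c, u1 <= c <= u2 -> continuity_pt G c).
  { intros c Hc. apply continuity_pt_filterlim, HGc. lra. }
  (* The extrema of [G] on the compact well bound the speed [g] above and away from 0. *)
  destruct (continuity_ab_min G u1 u2) as [xm [Hmin Hxm]]; [lra|auto|].
  destruct (continuity_ab_maj G u1 u2) as [xM [Hmax HxM]]; [lra|auto|].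
  assert (HXd : forall th, is_derive X th (B * sin th)).
  { intros th. unfold X. auto_derive; [auto|]. ring. }
  assert (Hgc : forall th, continuous g th).
  { intros th. unfold g. apply (continuous_comp (fun th => G (X th)) sqrt).
    - apply (continuous_comp X G).
      + eapply is_derive_continuous, HXd.
      + apply HGc. pose proof (HX th). lra.
    - apply continuous_sqrt. }
  destruct (periodic_flow g (sqrt (G xm)) (sqrt (G xM)) (2 * PI))
    as (th & T & HT & Hth & Hper & Hsurj).
  { apply sqrt_lt_R0. auto. }
  { pose proof PI_RGT_0. lra. }
  { exact Hgc. }
  { intros x. unfold g. pose proof (HX x).
    split; apply sqrt_le_1_alt; auto. }
  { intros x. unfold g, X. rewrite cos_plus, cos_2PI, sin_2PI.
    now replace (cos x * 1 - sin x * 0) with (cos x) by ring. }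
  set (U := fun t => X (th t)).
  set (V := fun t => B * sin (th t) * g (th t)).
  (* Conservation of energy: [(U - u1) (u2 - U) = B^2 sin^2 th] and [g^2 = G]. *)
  assert (HV2 : forall t, V t ^ 2 = F (U t)).
  { intros t. unfold V. rewrite (well_quotient_factor F dF u1 u2 _ W). fold G.
    rewrite 2!Rpow_mult_distr. unfold g.
    rewrite pow2_sqrt by (apply Rlt_le, HGp, HX). fold (U t).
    replace ((U t - u1) * (u2 - U t)) with (B ^ 2 * (1 - cos (th t) ^ 2))
      by (unfold U, X, A, B; field).
    rewrite <- !Rsqr_pow2, sin2. reflexivity. }
  assert (HUd : forall t, is_derive U t (V t)).
  { intros t. unfold U, V.
    replace (B * sin (th t) * g (th t)) with (g (th t) * (B * sin (th t))) by ring.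
    apply (is_derive_comp X th); auto. }
  assert (Hgth : forall t, continuous (fun s => g (th s)) t).
  { intros t. apply (continuous_comp th g); auto. eapply is_derive_continuous, Hth. }
  assert (Hsd : forall t, is_derive (fun s => B * sin (th s)) t (B * cos (th t) * g (th t))).
  { intros t. auto_derive.
    - now exists (g (th t)).
    - change (Derive (fun x => th x)) with (Derive th).
      rewrite (is_derive_unique th t _ (Hth t)). ring. }
  exists U, V, T. split; [auto|]. split; [|split; [|split; [|split]]].
  - intros t. unfold U, X. rewrite Hper, cos_plus, cos_2PI, sin_2PI. ring.
  - intros t. apply HX.
  - exact HUd.
  (* [G] is only continuous, so [V = B sin (th) g (th)] is differentiated through
     [V^2 = F (U)] off the turning points, and at them as a product whose first
     factor vanishes. *)
  - intros t. destruct (Req_dec (sin (th t)) 0) as [Hs|Hs].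
    + replace (dF (U t) / 2) with (B * cos (th t) * g (th t) * g (th t)).
      { apply (is_derive_mult_zero (fun s => B * sin (th s)) (fun s => g (th s))); auto.
        rewrite Hs. ring. }
      rewrite Rmult_assoc. unfold g. rewrite sqrt_sqrt by (apply Rlt_le, HGp, HX).
      fold (U t).
      assert (Hc : cos (th t) = 1 \/ cos (th t) = - 1).
      { pose proof (sin2_cos2 (th t)) as E. rewrite Hs in E. unfold Rsqr in E.
        assert (Hz : (cos (th t) - 1) * (cos (th t) + 1) = 0) by lra.
        apply Rmult_integral in Hz. lra. }
      destruct Hc as [Hc|Hc].
      * assert (EU : U t = u1) by (unfold U, X, A, B; rewrite Hc; field).
        rewrite EU, Hc. unfold G. rewrite well_quotient_left by auto. unfold B. field. lra.
      * assert (EU : U t = u2) by (unfold U, X, A, B; rewrite Hc; field).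
        rewrite EU, Hc. unfold G. rewrite well_quotient_right. unfold B. field. lra.
    + assert (HV0 : V t <> 0).
      { unfold V. pose proof (sqrt_lt_R0 _ (HGp _ (HX (th t)))). fold (g (th t)) in H.
        apply Rmult_integral_contrapositive. split; [|lra].
        apply Rmult_integral_contrapositive. lra. }
      replace (dF (U t) / 2) with ((V t * dF (U t)) / (2 * V t)) by (field; auto).
      apply is_derive_sqr_inv; auto.
      * apply (continuous_mult (K := R_AbsRing) (fun s => B * sin (th s)) (fun s => g (th s)));
          auto. eapply is_derive_continuous, Hsd.
      * apply is_derive_ext with (fun s => F (U s)); [now intros; rewrite HV2|].
        apply (is_derive_comp F U); auto. apply HF. pose proof (HX (th t)). unfold U. lra.
  - intros x y Hx Hy.
    (* The phases [w] and [-w] give the same position and opposite velocities. *)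
    assert (Hphase : forall w, X w = x -> exists t, U t = x /\ (V t = y \/ V t = - y) /\
              V t = B * sin w * g w).
    { intros w Hw. destruct (Hsurj w) as [t Ht]. exists t.
      assert (EU : U t = x) by (unfold U; now rewrite Ht).
      split; auto. split.
      - pose proof (HV2 t) as E. rewrite EU, <- Hy in E.
        assert (Hz : (V t - y) * (V t + y) = 0) by lra.
        apply Rmult_integral in Hz. lra.
      - unfold V. now rewrite Ht. }
    assert (HA : -1 <= (A - x) / B <= 1).
    { split; apply Rmult_le_reg_r with B; auto; unfold Rdiv;
        rewrite Rmult_assoc, Rinv_l by lra; unfold A, B; lra. }
    assert (Hw : forall w, cos w = (A - x) / B -> X w = x).
    { intros w E. unfold X. rewrite E. field. lra. }
    set (w := acos ((A - x) / B)).
    assert (Ew : cos w = (A - x) / B) by now apply cos_acos.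
    assert (Xw : X w = x) by auto.
    assert (Xw' : X (- w) = x) by (apply Hw; rewrite cos_neg; auto).
    destruct (Hphase w Xw) as (t & Et & [E|E] & Es); [now exists t|].
    destruct (Hphase (- w) Xw') as (t' & Et' & _ & Es').
    exists t'. split; auto. rewrite Es', sin_neg.
    replace (g (- w)) with (g w) by (unfold g; now rewrite Xw, Xw'). lra.
Qed.

(** * Uniqueness for Newton's equation *)

Lemma in_interval_convex (a b : Rbar) (s t x : R) :
  in_interval a b s -> in_interval a b t -> s <= x <= t -> in_interval a b x.
Proof.
  unfold in_interval. destruct a, b; simpl; try tauto; lra.
Qed.

Lemma in_interval_locally (a b : Rbar) (s : R) :
  in_interval a b s -> locally s (in_interval a b).
Proof.
  intros [Ha Hb]. apply filter_and; [now apply open_Rbar_gt|now apply open_Rbar_lt].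
Qed.

(** Gronwall's argument: [exp (- K x) E x] does not increase, which settles [s > s0], and
    [exp (K x) E x] does not decrease, which settles [s < s0]. *)
Lemma gronwall_zero (E dE : R -> R) (K : R) (a b : Rbar) (s0 s : R) :
  (forall x, in_interval a b x -> is_derive E x (dE x)) ->
  (forall x, in_interval a b x -> 0 <= E x) ->
  (forall x, in_interval a b x -> Rabs (dE x) <= K * E x) ->
  in_interval a b s0 -> in_interval a b s -> E s0 = 0 -> E s = 0.
Proof.
  intros Hd Hpos Hb Hs0 Hs H0.
  assert (Hexp : forall k x, in_interval a b x ->
    is_derive (fun y => exp (k * y) * E y) x (exp (k * x) * (k * E x + dE x))).
  { intros k x Hx. auto_derive.
    - now exists (dE x); auto.
    - change (Derive (fun y => E y)) with (Derive E).
      rewrite (is_derive_unique E x _ (Hd x Hx)). ring. }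
  destruct (Rtotal_order s0 s) as [L|[<-|L]]; auto.
  - destruct (is_derive_MVT _ _ s0 s L
      (fun x Hx => Hexp (- K) x (in_interval_convex a b s0 s x Hs0 Hs Hx))) as [c [Hc He]].
    assert (Hci : in_interval a b c) by (apply (in_interval_convex a b s0 s); auto; lra).
    pose proof (Hb c Hci). pose proof (Rle_abs (dE c)).
    pose proof (exp_pos (- K * c)). pose proof (exp_pos (- K * s)).
    pose proof (Hpos s Hs). rewrite H0 in He.
    assert (exp (- K * c) * (- K * E c + dE c) <= 0) by nra.
    assert (exp (- K * s) * E s <= 0) by nra. nra.
  - destruct (is_derive_MVT _ _ s s0 L
      (fun x Hx => Hexp K x (in_interval_convex a b s s0 x Hs Hs0 Hx))) as [c [Hc He]].
    assert (Hci : in_interval a b c) by (apply (in_interval_convex a b s s0); auto; lra).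
    pose proof (Hb c Hci). pose proof (Rle_abs (- dE c)). rewrite Rabs_Ropp in *.
    pose proof (exp_pos (K * c)). pose proof (exp_pos (K * s)).
    pose proof (Hpos s Hs). rewrite H0 in He.
    assert (0 <= exp (K * c) * (K * E c + dE c)) by nra.
    assert (exp (K * s) * E s <= 0) by nra. nra.
Qed.

(** The squared distance [E] in the phase plane satisfies [|E'| <= (1 + K) E], by the Lipschitz
    bound and [2 |x| |y| <= x^2 + y^2]. *)
Lemma second_order_unique (f : R -> R) (K u1 u2 : R) (a b : Rbar)
    (u v w z : R -> R) (s0 s : R) :
  0 <= K ->
  (forall x y, u1 <= x <= u2 -> u1 <= y <= u2 -> Rabs (f x - f y) <= K * Rabs (x - y)) ->
  (forall t, in_interval a b t ->
     u1 <= u t <= u2 /\ is_derive u t (v t) /\ is_derive v t (f (u t))) ->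
  (forall t, in_interval a b t ->
     u1 <= w t <= u2 /\ is_derive w t (z t) /\ is_derive z t (f (w t))) ->
  in_interval a b s0 -> in_interval a b s ->
  u s0 = w s0 -> v s0 = z s0 -> u s = w s.
Proof.
  intros HK Hf Hu Hw Hs0 Hs E1 E2.
  set (E := fun t => (u t - w t) ^ 2 + (v t - z t) ^ 2).
  assert (HE : E s = 0).
  { apply (gronwall_zero E
      (fun t => 2 * (u t - w t) * (v t - z t) + 2 * (v t - z t) * (f (u t) - f (w t)))
      (1 + K) a b s0); auto.
    - intros t Ht. destruct (Hu t Ht) as (_ & Du & Dv). destruct (Hw t Ht) as (_ & Dw & Dz).
      unfold E. auto_derive.
      + repeat split; try (eexists; eassumption).
      + change (Derive (fun x => u x)) with (Derive u).
        change (Derive (fun x => v x)) with (Derive v).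
        change (Derive (fun x => w x)) with (Derive w).
        change (Derive (fun x => z x)) with (Derive z).
        rewrite (is_derive_unique _ _ _ Du), (is_derive_unique _ _ _ Dv),
          (is_derive_unique _ _ _ Dw), (is_derive_unique _ _ _ Dz). ring.
    - intros t _. unfold E. apply Rplus_le_le_0_compat; apply pow2_ge_0.
    - intros t Ht. destruct (Hu t Ht) as (Ru & _). destruct (Hw t Ht) as (Rw & _).
      pose proof (Hf _ _ Ru Rw) as HL. unfold E.
      set (x := u t - w t) in *. set (y := v t - z t).
      set (q := f (u t) - f (w t)) in *.
      apply Rle_trans with (1 := Rabs_triang _ _).
      rewrite !Rabs_mult, (Rabs_right 2) by lra.
      replace (x ^ 2) with (Rabs x ^ 2) by apply pow2_abs.
      replace (y ^ 2) with (Rabs y ^ 2) by apply pow2_abs.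
      pose proof (Rabs_pos x). pose proof (Rabs_pos y).
      assert (Rabs y * Rabs q <= Rabs y * (K * Rabs x)) by now apply Rmult_le_compat_l.
      assert (0 <= K * (Rabs x - Rabs y) ^ 2) by (apply Rmult_le_pos; [auto|apply pow2_ge_0]).
      pose proof (pow2_ge_0 (Rabs x - Rabs y)). lra.
    - unfold E. rewrite E1, E2. ring. }
  unfold E in HE. pose proof (pow2_ge_0 (u s - w s)). pose proof (pow2_ge_0 (v s - z s)).
  assert (Hz : (u s - w s) * (u s - w s) = 0) by lra.
  apply Rmult_integral in Hz. lra.
Qed.

(** * Real powers and the energy function *)

Lemma is_derive_Rpower_comp (f : R -> R) (e s l : R) :
  0 < f s -> is_derive f s l ->
  is_derive (fun t => Rpower (f t) e) s (l * (e * Rpower (f s) (e - 1))).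
Proof.
  intros Hp Hf. apply (is_derive_comp (fun x => Rpower x e) f); auto.
  apply is_derive_Reals. now apply derivable_pt_lim_power.
Qed.

Lemma is_derive_Rpower (e x : R) :
  0 < x -> is_derive (fun y => Rpower y e) x (e * Rpower x (e - 1)).
Proof. intros Hx. apply is_derive_Reals. now apply derivable_pt_lim_power. Qed.

Lemma Derive_Rpower (e x : R) :
  0 < x -> Derive (fun y : R => Rpower y e) x = e * Rpower x (e - 1).
Proof. intros Hx. now apply is_derive_unique, is_derive_Rpower. Qed.

Lemma Rpower_pos (x e : R) : 0 < Rpower x e.
Proof. apply exp_pos. Qed.

Lemma Rpower_neg_lt (x y e : R) : 0 < e -> 0 < x < y -> Rpower y (- e) < Rpower x (- e).
Proof.
  intros He Hxy. rewrite 2!Rpower_Ropp. apply Rinv_lt_contravar.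
  - apply Rmult_lt_0_compat; apply Rpower_pos.
  - now apply Rlt_Rpower_l.
Qed.

(** This is the function [F] of the introduction, with [D] in place of [d / p^2]; the force in
    Newton's equation is [denergy / 2]. *)
Definition energy (D rho c m x : R) : R := D - rho * x ^ 2 - c * Rpower x (- m).

Definition denergy (rho c m x : R) : R := - 2 * rho * x + c * m * Rpower x (- (m + 1)).

Lemma is_derive_energy (D rho c m x : R) :
  0 < x -> is_derive (energy D rho c m) x (denergy rho c m x).
Proof.
  intros Hx. pose proof (is_derive_Rpower (- m) x Hx) as HR. unfold energy.
  auto_derive.
  - now eexists; apply HR.
  - rewrite Derive_Rpower by auto. unfold denergy.
    replace (- m - 1) with (- (m + 1)) by ring. ring.
Qed.

(** The energy is positive at [x0] and negative both close to 0 and far out, so the intermediate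
    value theorem gives a zero on each side of [x0]. *)
Lemma energy_well (D rho c m x0 : R) :
  0 < rho -> 0 < c -> 0 < m -> 0 < x0 -> 0 < energy D rho c m x0 ->
  exists u1 u2, concave_well (energy D rho c m) (denergy rho c m) u1 u2.
Proof.
  intros Hr Hc Hm Hx0 HE.
  set (F := energy D rho c m) in *.
  assert (Hcont : forall x, 0 < x -> continuity_pt F x).
  { intros x Hx. apply continuity_pt_filterlim.
    eapply is_derive_continuous, is_derive_energy, Hx. }
  pose proof (Rpower_pos x0 (- m)) as P0.
  assert (HD : c * Rpower x0 (- m) < D) by (unfold F, energy in HE; nra).
  assert (HD0 : 0 < D) by nra.
  (* At [l] the singular term equals [D], which leaves the energy [- rho l^2 < 0]. *)
  set (l := Rpower (D / c) (- / m)).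
  assert (Hl0 : 0 < l) by apply Rpower_pos.
  assert (Hl : c * Rpower l (- m) = D).
  { unfold l. rewrite Rpower_mult. replace (- / m * - m) with 1 by (field; lra).
    rewrite Rpower_1 by (now apply Rdiv_lt_0_compat). field. lra. }
  assert (Hlx : l < x0).
  { destruct (Rlt_le_dec l x0) as [|[L|<-]]; auto; [|lra].
    pose proof (Rpower_neg_lt x0 l m Hm (conj Hx0 L)). nra. }
  (* Both [r > 1] and [rho r > D] hold, hence [rho r^2 > D] and the energy at [r] is negative. *)
  set (r := x0 + 1 + D / rho).
  assert (Hrr : rho * r = rho * (x0 + 1) + D) by (unfold r; field; lra).
  assert (Hr0 : 0 < D / rho) by now apply Rdiv_lt_0_compat.
  assert (Hxr : x0 + 1 < r) by (unfold r; lra).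
  destruct (Ranalysis5.IVT_interv F l x0) as [u1 [Hu1 E1]]; auto.
  { intros x Hx. apply Hcont. lra. }
  { unfold F, energy.
    assert (0 < rho * l ^ 2) by (apply Rmult_lt_0_compat; [|apply pow_lt]; auto). lra. }
  destruct (Ranalysis5.IVT_interv (fun x => - F x) x0 r) as [u2 [Hu2 E2]]; try lra.
  { intros x Hx. apply continuity_pt_opp, Hcont. lra. }
  { unfold F, energy. pose proof (Rpower_pos r (- m)).
    assert (0 < c * Rpower r (- m)) by now apply Rmult_lt_0_compat.
    assert (D < rho * r) by nra.
    assert (rho * r <= rho * r ^ 2) by nra. lra. }
  exists u1, u2. repeat apply conj; auto; try lra.
  - assert (u1 <> x0) by (intros ->; lra). assert (u2 <> x0) by (intros ->; lra). lra.
  - intros x Hx. now apply is_derive_energy.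
  - intros x y Hxy. unfold denergy.
    pose proof (Rpower_neg_lt x y (m + 1)).
    assert (0 < c * m) by now apply Rmult_lt_0_compat.
    assert (Rpower y (- (m + 1)) < Rpower x (- (m + 1))) by (apply Rpower_neg_lt; lra).
    nra.
Qed.

(** The derivative of the force involves [x^(-(m + 2))], which is largest at [u1] when [x >= u1];
    the mean value theorem then applies. *)
Lemma denergy_lipschitz (rho c m u1 : R) :
  0 < rho -> 0 < c -> 0 < m -> 0 < u1 ->
  exists K, 0 <= K /\ forall x y, u1 <= x -> u1 <= y ->
    Rabs (denergy rho c m x / 2 - denergy rho c m y / 2) <= K * Rabs (x - y).
Proof.
  intros Hr Hc Hm Hu.
  set (C := c * m * (m + 1)).
  assert (HC : 0 < C) by (unfold C; repeat apply Rmult_lt_0_compat; lra).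
  set (K := rho + C * Rpower u1 (- (m + 2))).
  pose proof (Rpower_pos u1 (- (m + 2))) as P1.
  assert (HK : 0 <= K) by (unfold K; nra).
  exists K. split; auto.
  assert (Hd : forall x, u1 <= x -> is_derive (fun x => denergy rho c m x / 2) x
             (- rho - C / 2 * Rpower x (- (m + 2)))).
  { intros x Hx. assert (Hx0 : 0 < x) by lra.
    pose proof (is_derive_Rpower (- (m + 1)) x Hx0) as HR.
    unfold denergy. auto_derive.
    - now eexists; apply HR.
    - rewrite Derive_Rpower by auto.
      replace (- (m + 1) - 1) with (- (m + 2)) by ring. unfold C. field. }
  assert (Hb : forall x, u1 <= x -> Rabs (- rho - C / 2 * Rpower x (- (m + 2))) <= K).
  { intros x Hx. pose proof (Rpower_pos x (- (m + 2))).
    assert (Rpower x (- (m + 2)) <= Rpower u1 (- (m + 2))).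
    { destruct Hx as [Hx| ->]; [|lra]. apply Rlt_le, Rpower_neg_lt; lra. }
    apply Rabs_le. unfold K. split; nra. }
  assert (Hlt : forall x y, u1 <= x -> x < y ->
    Rabs (denergy rho c m y / 2 - denergy rho c m x / 2) <= K * Rabs (y - x)).
  { intros x y Hx Hxy.
    destruct (is_derive_MVT (fun x => denergy rho c m x / 2) _ x y Hxy
      (fun t Ht => Hd t (Rle_trans _ _ _ Hx (proj1 Ht)))) as [t [Ht ->]].
    rewrite Rabs_mult. apply Rmult_le_compat_r; [apply Rabs_pos|]. apply Hb. lra. }
  intros x y Hx Hy. destruct (Rtotal_order x y) as [L|[->|L]].
  - rewrite Rabs_minus_sym, (Rabs_minus_sym x). auto.
  - rewrite !Rminus_diag, Rabs_R0. lra.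
  - auto.
Qed.

(** * Passage between the curvature and Newton's equation *)

Lemma Rpower_sub1 (x e : R) : 0 < x -> Rpower x (e - 1) = Rpower x e / x.
Proof.
  intros Hx. unfold Rminus. now rewrite Rpower_plus, Rpower_Ropp, Rpower_1.
Qed.

Lemma Rpower_inverse (x e e' : R) : 0 < x -> e * e' = 1 -> Rpower (Rpower x e) e' = x.
Proof. intros Hx He. now rewrite Rpower_mult, He, Rpower_1. Qed.

(** These are [m] and [c] of the introduction: for [u = kappa^(p - 1)] one has
    [u^(-m) = kappa^(2 p)], whose coefficient in the first integral for [u] is [- c]. *)
Definition well_exponent (p : R) : R := 2 * p / (1 - p).
Definition well_coeff (p : R) : R := ((1 - p) / p) ^ 2.

(** The key identity is [u^(-(m + 1)) = kappa^(p + 1) = u kappa^2], which turns every power of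
    [kappa] into one of [u]; moreover [c m = 2 (1 - p) / p]. *)
Lemma euler_lagrange_newton (p rho : R) (a b : Rbar) (kappa : R -> R) (s : R) :
  let u := fun t => Rpower (kappa t) (p - 1) in
  0 < p < 1 -> euler_lagrange_solution p rho a b kappa -> in_interval a b s ->
  is_derive u s (Derive u s) /\
  is_derive (Derive u) s (denergy rho (well_coeff p) (well_exponent p) (u s) / 2).
Proof.
  intros u Hp [Htd HEL] Hs.
  assert (Hu : forall t, in_interval a b t ->
    is_derive u t (Derive kappa t * ((p - 1) * Rpower (kappa t) (p - 1 - 1)))).
  { intros t Ht. destruct (HEL t Ht) as [Hk _]. apply is_derive_Rpower_comp; auto.
    apply Derive_correct, Htd, Ht. }
  split.
  { apply Derive_correct. eexists. now apply Hu. }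
  assert (Hex : ex_derive (Derive u) s).
  { apply ex_derive_ext_loc with
      (fun t => Derive kappa t * ((p - 1) * Rpower (kappa t) (p - 1 - 1))).
    - generalize (in_interval_locally a b s Hs). apply filter_imp. intros t Ht.
      symmetry. apply is_derive_unique. auto.
    - destruct (HEL s Hs) as [Hk _]. destruct (Htd s Hs) as [D1 D2].
      apply ex_derive_mult; auto. apply ex_derive_scal.
      eexists. apply is_derive_Rpower_comp; auto. now apply Derive_correct. }
  replace (denergy rho (well_coeff p) (well_exponent p) (u s) / 2) with (Derive (Derive u) s).
  { now apply Derive_correct. }
  destruct (HEL s Hs) as [Hk E].
  change (Derive_n (fun t => p * u t) 2 s + p * u s * (kappa s ^ 2 + rho)
            - Rpower (kappa s) (p + 1) = 0) in E.
  rewrite (Derive_n_scal_l u 2 p s) in E.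
  change (Derive_n u 2 s) with (Derive (Derive u) s) in E.
  assert (E1 : Rpower (kappa s) (p + 1) = Rpower (u s) (- (well_exponent p + 1))).
  { unfold u. rewrite Rpower_mult. f_equal. unfold well_exponent. field. lra. }
  assert (E2 : Rpower (kappa s) (p + 1) = u s * kappa s ^ 2).
  { unfold u. replace (p + 1) with (p - 1 + INR 2) by (simpl; ring).
    now rewrite Rpower_plus, Rpower_pow. }
  unfold denergy. rewrite <- E1, E2 in *.
  replace (well_coeff p * well_exponent p) with (2 * (1 - p) / p)
    by (unfold well_coeff, well_exponent; field; lra).
  apply Rmult_eq_reg_l with p; [|lra].
  transitivity (u s * kappa s ^ 2 - p * u s * (kappa s ^ 2 + rho)); [lra|field; lra].
Qed.

(** By the chain rule [u'^2] is the first integral for [kappa] times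
    [(p - 1)^2 kappa^(2 (p - 2))]. *)
Lemma first_integral_energy (p rho d : R) (a b : Rbar) (kappa : R -> R) (s : R) :
  let u := fun t => Rpower (kappa t) (p - 1) in
  0 < p < 1 -> euler_lagrange_solution p rho a b kappa ->
  constant_of_integration p rho d a b kappa -> in_interval a b s ->
  Derive u s ^ 2 = energy (d / p ^ 2) rho (well_coeff p) (well_exponent p) (u s).
Proof.
  intros u Hp [Htd HEL] Hd Hs. destruct (HEL s Hs) as [Hk _].
  assert (Hu : is_derive u s (Derive kappa s * ((p - 1) * Rpower (kappa s) (p - 1 - 1)))).
  { apply is_derive_Rpower_comp; auto. now apply Derive_correct, Htd. }
  rewrite (is_derive_unique _ _ _ Hu). unfold energy, u. rewrite Rpower_mult.
  replace ((p - 1) * - well_exponent p) with (p + p) by (unfold well_exponent; field; lra).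
  rewrite Rpower_plus, !Rpow_mult_distr, (Hd s Hs), !Rpower_sub1 by auto.
  (* Splitting the exponents leaves a rational identity in [kappa s] and [Rpower (kappa s) p]. *)
  replace (2 * (1 - p)) with (INR 2 + (- p + - p)) by (simpl; ring).
  rewrite !Rpower_plus, Rpower_Ropp, Rpower_pow by auto.
  pose proof (Rpower_pos (kappa s) p). unfold well_coeff. field. repeat split; lra.
Qed.

(** The converse passage turns the global solution in the well into a competitor on the whole line
    for the maximality hypothesis. *)
Lemma newton_euler_lagrange (p rho : R) (U V : R -> R) :
  0 < p < 1 -> (forall t, 0 < U t) -> (forall t, is_derive U t (V t)) ->
  (forall t, is_derive V t (denergy rho (well_coeff p) (well_exponent p) (U t) / 2)) ->
  euler_lagrange_solution p rho m_infty p_infty (fun t => Rpower (U t) (/ (p - 1))).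
Proof.
  intros Hp HU HD1 HD2. set (k := fun t => Rpower (U t) (/ (p - 1))).
  set (e := / (p - 1)) in *.
  assert (Hk : forall t, is_derive k t (V t * (e * Rpower (U t) (e - 1)))).
  { intros t. now apply is_derive_Rpower_comp. }
  assert (HkU : forall t, Rpower (k t) (p - 1) = U t).
  { intros t. apply Rpower_inverse; auto. unfold e. field. lra. }
  split.
  - intros s _. split; [eexists; apply Hk|].
    apply ex_derive_ext with (fun t => V t * (e * Rpower (U t) (e - 1))).
    + intros t. symmetry. apply is_derive_unique, Hk.
    + apply ex_derive_mult; [eexists; apply HD2|]. apply ex_derive_scal.
      eexists. now apply is_derive_Rpower_comp.
  - intros s _. split; [apply Rpower_pos|].
    rewrite (Derive_n_scal_l (fun t => Rpower (k t) (p - 1)) 2 p s).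
    rewrite (Derive_n_ext (fun t => Rpower (k t) (p - 1)) U) by auto.
    change (Derive_n U 2 s) with (Derive (Derive U) s).
    rewrite (Derive_ext (Derive U) V) by (intros; now apply is_derive_unique).
    rewrite (is_derive_unique _ _ _ (HD2 s)), HkU.
    assert (E1 : Rpower (U s) (- (well_exponent p + 1)) = Rpower (k s) (p + 1)).
    { unfold k. rewrite Rpower_mult. f_equal. unfold well_exponent, e. field. lra. }
    assert (E2 : Rpower (k s) (p + 1) = U s * k s ^ 2).
    { rewrite <- (HkU s) at 1. replace (p + 1) with (p - 1 + INR 2) by (simpl; ring).
      rewrite Rpower_plus, Rpower_pow; auto. apply Rpower_pos. }
    unfold denergy. rewrite E1, E2. unfold well_coeff, well_exponent. field. lra.
Qed.

(** * Periodicity according to the sign of the ambient curvature *)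

(** Rolle's theorem on two consecutive periods gives two zeros of [f'], and between them a zero of
    [f'']. *)
Lemma not_periodic_of_convex (f f' f'' : R -> R) (a b : Rbar) (s : R) :
  in_interval a b s ->
  (forall t, in_interval a b t -> is_derive f t (f' t) /\ is_derive f' t (f'' t)) ->
  (forall t, in_interval a b t -> 0 < f'' t) -> ~ periodic_on a b f.
Proof.
  intros Hs Hd Hpos (T & HT & Hdom & Hper).
  assert (H1 : in_interval a b (s + T)) by (apply (proj1 (Hdom s)); auto).
  assert (H2 : in_interval a b (s + T + T)) by (apply (proj1 (Hdom (s + T))); auto).
  pose proof (in_interval_convex a b s (s + T + T)) as Hc.
  destruct (is_derive_MVT f f' s (s + T)) as [x [Hx Ex]]; try lra.
  { intros t Ht. apply Hd, Hc; auto; lra. }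
  destruct (is_derive_MVT f f' (s + T) (s + T + T)) as [y [Hy Ey]]; try lra.
  { intros t Ht. apply Hd, Hc; auto; lra. }
  pose proof (Hper s Hs). pose proof (Hper (s + T) H1).
  assert (Zx : f' x = 0) by nra. assert (Zy : f' y = 0) by nra.
  destruct (is_derive_MVT f' f'' x y) as [z [Hz Ez]]; try lra.
  { intros t Ht. apply Hd, Hc; auto; lra. }
  assert (0 < f'' z) by (apply Hpos, Hc; auto; lra). rewrite Zx, Zy in Ez. nra.
Qed.

Lemma nonconstant_derive (f f' : R -> R) (a b : Rbar) :
  (forall t, in_interval a b t -> is_derive f t (f' t)) ->
  nonconstant_on a b f -> exists s, in_interval a b s /\ f' s <> 0.
Proof.
  intros Hd.
  assert (W : forall s t, in_interval a b s -> in_interval a b t -> s < t -> f s <> f t ->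
     exists s, in_interval a b s /\ f' s <> 0).
  { intros s t Hs Ht L Hne.
    destruct (is_derive_MVT f f' s t L) as [x [Hx E]].
    - intros x Hx. now apply Hd, (in_interval_convex a b s t).
    - exists x. split; [apply (in_interval_convex a b s t); auto; lra|].
      intros H0. rewrite H0 in E. lra. }
  intros (s & t & Hs & Ht & Hne).
  destruct (Rtotal_order s t) as [L|[->|L]].
  - now apply (W s t).
  - now destruct Hne.
  - now apply (W t s); auto.
Qed.

Lemma periodic_of_positive_curvature (p rho d : R) (a b : Rbar) (kappa : R -> R) :
  0 < p < 1 -> 0 < rho -> euler_lagrange_solution p rho a b kappa ->
  nonconstant_on a b kappa -> constant_of_integration p rho d a b kappa ->
  maximal_domain p rho a b kappa -> periodic_on a b kappa.
Proof.
  intros Hp Hr HEL Hnc Hd Hmax.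
  set (u := fun t => Rpower (kappa t) (p - 1)).
  set (c := well_coeff p). set (m := well_exponent p).
  assert (Hc : 0 < c).
  { unfold c, well_coeff. apply pow_lt, Rdiv_lt_0_compat; lra. }
  assert (Hm : 0 < m) by (unfold m, well_exponent; apply Rdiv_lt_0_compat; lra).
  assert (Hnewton : forall t, in_interval a b t ->
    is_derive u t (Derive u t) /\ is_derive (Derive u) t (denergy rho c m (u t) / 2)).
  { intros t Ht. now apply (euler_lagrange_newton p rho a b kappa t). }
  assert (Henergy : forall t, in_interval a b t ->
    Derive u t ^ 2 = energy (d / p ^ 2) rho c m (u t)).
  { intros t Ht. now apply (first_integral_energy p rho d a b kappa t). }
  assert (Hku : forall t, in_interval a b t -> kappa t = Rpower (u t) (/ (p - 1))).
  { intros t Ht. symmetry. apply Rpower_inverse; [|field; lra]. now apply HEL. }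
  assert (Hnu : nonconstant_on a b u).
  { destruct Hnc as (s & t & Hs & Ht & Hne). exists s, t. repeat split; try apply Hs; try apply Ht.
    intros E. apply Hne. now rewrite (Hku s Hs), (Hku t Ht), E. }
  (* At [s0] the energy equals [u'^2 > 0], which is what creates the well. *)
  destruct (nonconstant_derive u (Derive u) a b) as [s0 [Hs0 Hne]]; auto.
  { intros t Ht. now apply Hnewton. }
  destruct (energy_well (d / p ^ 2) rho c m (u s0)) as (u1 & u2 & W); auto.
  { apply Rpower_pos. }
  { rewrite <- Henergy by auto. now apply pow2_gt_0. }
  assert (Hrange : forall t, in_interval a b t -> u1 <= u t <= u2).
  { intros t Ht. apply (concave_well_range _ _ u1 u2 (u t) W).
    - apply Rpower_pos.
    - rewrite <- Henergy by auto. apply pow2_ge_0. }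
  assert (Hu1 : 0 < u1) by (destruct W; lra).
  destruct (concave_well_periodic_solution _ _ u1 u2 W)
    as (U & V & T & HT & HUper & HUr & HU & HV & Hphase).
  destruct (Hphase (u s0) (Derive u s0)) as (t0 & EU & EV); auto.
  destruct (denergy_lipschitz rho c m u1) as (K & HK & HLip); auto.
  (* This time shift makes position and velocity of the two solutions agree at [s0]. *)
  set (tau := t0 - s0).
  assert (Hshift : forall (f f' : R -> R), (forall t, is_derive f t (f' t)) ->
    forall t, is_derive (fun x => f (x + tau)) t (f' (t + tau))).
  { intros f f' Hf t. replace (f' (t + tau)) with (1 * f' (t + tau)) by ring.
    apply (is_derive_comp f (fun x => x + tau)); auto. auto_derive; auto. }
  assert (HuU : forall t, in_interval a b t -> u t = U (t + tau)).
  { intros t Ht.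
    apply (second_order_unique (fun x => denergy rho c m x / 2) K u1 u2 a b
      u (Derive u) (fun x => U (x + tau)) (fun x => V (x + tau)) s0 t); auto.
    - intros x y Hx Hy. apply HLip; lra.
    - intros x _. split; [auto|]. split; [now apply Hshift|].
      now apply (Hshift V (fun x => denergy rho c m (U x) / 2)).
    - unfold tau. now replace (s0 + (t0 - s0)) with t0 by ring.
    - unfold tau. now replace (s0 + (t0 - s0)) with t0 by ring. }
  set (k := fun t => Rpower (U (t + tau)) (/ (p - 1))).
  assert (Hkk : forall t, in_interval a b t -> k t = kappa t).
  { intros t Ht. unfold k. rewrite (Hku t Ht), (HuU t Ht). reflexivity. }
  (* The solution [k] lives on the whole line and extends [kappa], so maximality forces the domain
     to be the line. *)
  assert (Hall : forall t, in_interval a b t).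
  { intros t. apply (Hmax m_infty p_infty k).
    - apply (newton_euler_lagrange p rho (fun x => U (x + tau)) (fun x => V (x + tau))); auto.
      + intros x. pose proof (HUr (x + tau)). lra.
      + apply (Hshift V (fun x => denergy rho c m (U x) / 2)). auto.
    - intros s Hs. split; [split; exact I|auto].
    - split; exact I. }
  exists T. split; [auto|]. split.
  - intros s. split; auto.
  - intros s Hs. rewrite <- !Hkk by auto. unfold k.
    replace (s + T + tau) with (s + tau + T) by ring. now rewrite HUper.
Qed.

(** For [rho <= 0] the force has no attracting term: [- rho u >= 0] and the power term is positive.
    A period of [kappa] is also one of [u]. *)
Lemma not_periodic_of_nonpositive_curvature (p rho : R) (a b : Rbar) (kappa : R -> R) (s : R) :
  0 < p < 1 -> rho <= 0 -> euler_lagrange_solution p rho a b kappa ->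
  in_interval a b s -> ~ periodic_on a b kappa.
Proof.
  intros Hp Hr HEL Hs Hper.
  set (u := fun t => Rpower (kappa t) (p - 1)).
  set (c := well_coeff p). set (m := well_exponent p).
  apply (not_periodic_of_convex u (Derive u) (fun t => denergy rho c m (u t) / 2) a b s Hs).
  - intros t Ht. now apply (euler_lagrange_newton p rho a b kappa t).
  - intros t _. unfold denergy.
    pose proof (Rpower_pos (kappa t) (p - 1)) as Hu. fold (u t) in Hu.
    pose proof (Rpower_pos (u t) (- (m + 1))).
    assert (0 < c) by (unfold c, well_coeff; apply pow_lt, Rdiv_lt_0_compat; lra).
    assert (0 < m) by (unfold m, well_exponent; apply Rdiv_lt_0_compat; lra).
    assert (0 < c * m * Rpower (u t) (- (m + 1)))
      by (apply Rmult_lt_0_compat; [now apply Rmult_lt_0_compat|auto]).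
    nra.
  - destruct Hper as (T & HT & Hdom & Hper). exists T. split; [|split]; auto.
    intros t Ht. unfold u. now rewrite Hper.
Qed.

Theorem proposition4p1 (n : nat) (p rho d : R) (a b : Rbar) (gamma : R -> vec3)
  (hn : (3 <= n)%nat)
  (hp : p = (INR n - 2) / (INR n + 1))
  (hd : 0 < d)
  (helastic : p_elastic_curve p rho a b gamma)
  (hnonconst : nonconstant_on a b (signed_curvature rho gamma))
  (hconst : constant_of_integration p rho d a b (signed_curvature rho gamma))
  (hmax : maximal_domain p rho a b (signed_curvature rho gamma)) :
  periodic_on a b (signed_curvature rho gamma) <-> 0 < rho.
Proof.
  assert (Hp : 0 < p < 1).
  { apply le_INR in hn. simpl in hn. rewrite hp. split.
    - apply Rdiv_lt_0_compat; lra.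
    - apply Rmult_lt_reg_r with (INR n + 1); [lra|].
      unfold Rdiv. rewrite Rmult_assoc, Rinv_l by lra. lra. }
  destruct helastic as [_ HEL]. split.
  - intros Hper. destruct (Rlt_le_dec 0 rho) as [|Hr]; auto.
    (* Nonconstancy supplies a point of the domain, on which the convexity argument starts. *)
    destruct hnonconst as (s & _ & Hs & _).
    now destruct (not_periodic_of_nonpositive_curvature p rho a b _ s Hp Hr HEL Hs).
  - intros Hr. now apply (periodic_of_positive_curvature p rho d).
Qed.
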